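(* Let $G$ be a group and $\mathcal{C}_G^\times$ a $G$-crossed braided tensor category extending a unitary modular tensor category $\mathcal{C}_{\mathbf 0}$, such that $G$ does not permute the anyons. Fix Abelian defects $0_{\mathbf g}\in\mathcal{C}_{\mathbf g}$ for all $\mathbf g\in G$, with fusion rule $0_{\mathbf g}\times0_{\mathbf h}=\mathfrak{w}(\mathbf g,\mathbf h)\times0_{\mathbf{gh}}$. For any $\mathbf g_1,\dots,\mathbf g_n\in G$ and any (possibly non-Abelian) anyon $a\in\mathcal{C}_{\mathbf 0}$ define $$\mathcal{F}_a(\mathbf g_1,\dots,\mathbf g_n)=\frac{\prod_{i=1}^nR^{a,0_{\mathbf g_i}}R^{0_{\mathbf g_i},a}}{R^{a,0_{\mathbf g_n\cdots\mathbf g_1}}R^{0_{\mathbf g_n\cdots\mathbf g_1},a}}\ \prod_{i=1}^{n-1}\eta_a(\mathbf g_{i+1},\mathbf g_i\cdots\mathbf g_1).$$ Then $\mathcal{F}_a(\mathbf g_1,\dots,\mathbf g_n)$ is invariant under vertex basis and symmetry action gauge transformations, and $$\mathcal{F}_a(\mathbf g_1,\dots,\mathbf g_n)=M_{a,f},\qquad f=\prod_{i=1}^{n-1}\mathfrak{w}(\mathbf g_{i+1},\mathbf g_i\cdots\mathbf g_1)\in\mathcal{A}.$$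
   Context: $\mathcal{C}_{\mathbf 0}$ is a unitary modular tensor category (its simple objects are ''anyons''); $\mathcal{A}$ is the finite Abelian group of Abelian (quantum dimension 1) anyons under fusion; for $b\in\mathcal{A}$ and any anyon $a$, $M_{a,b}=R^{a,b}R^{b,a}\in U(1)$ is the double braid. $\mathbf 0$ denotes the identity of $G$, $\bar{\mathbf g}=\mathbf g^{-1}$. A $G$-crossed braided tensor category (BTC) $\mathcal{C}_G^\times=\bigoplus_{\mathbf g\in G}\mathcal{C}_{\mathbf g}$ is a $G$-graded unitary fusion-type category with trivial component $\mathcal{C}_{\mathbf 0}$, a $G$-action $x\mapsto{}^{\mathbf k}x$ mapping $\mathcal{C}_{\mathbf g}\to\mathcal{C}_{\mathbf{kgk}^{-1}}$, and a $G$-crossed braiding ($c_{\mathbf k}\times a_{\mathbf g}={}^{\mathbf k}a_{\mathbf g}\times c_{\mathbf k}$). Simple objects of $\mathcal{C}_{\mathbf g}$ are called $\mathbf g$-defects. Skeletally it is given by data $\{F,R,U,\eta\}$: $F$-symbols satisfying the pentagon equation; $G$-crossed $R$-symbols; phases/matrices $U_{\mathbf k}(a,b;c)$ for the action of $\mathbf k$ on splitting spaces; phases $\eta_x(\mathbf g,\mathbf h)$ relating the action of $\mathbf g\mathbf h$ to the composition of the actions, with $U_{\mathbf 0}=1$, $\eta_0=1$, $\eta_x(\mathbf g,\mathbf 0)=\eta_x(\mathbf 0,\mathbf h)=1$. When fusion outcomes are unique (e.g. at most one non-Abelian object is involved) subscripts are dropped, and for $a\in\mathcal{C}_{\mathbf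 g},b\in\mathcal{C}_{\mathbf h},c\in\mathcal{C}_{\mathbf k}$ the consistency (heptagon) equations read $R^{a,c}F^{a,c,{}^{\bar{\mathbf k}}b}R^{b,c}=F^{c,{}^{\bar{\mathbf k}}a,{}^{\bar{\mathbf k}}b}\,U_{\mathbf k}(a,b)\,R^{ab,c}F^{a,b,c}$ and $(R^{c,a})^{-1}F^{a,{}^{\bar{\mathbf g}}c,b}(R^{{}^{\bar{\mathbf g}}c,b})^{-1}=F^{c,a,b}\,\eta_c(\mathbf g,\mathbf h)\,(R^{c,ab})^{-1}F^{a,b,{}^{\bar{\mathbf h}\bar{\mathbf g}}c}$, together with $\eta_x(\mathbf g,\mathbf h)\eta_x(\mathbf{gh},\mathbf k)=\eta_{{}^{\bar{\mathbf g}}x}(\mathbf h,\mathbf k)\eta_x(\mathbf g,\mathbf{hk})$ and $\eta_a(\mathbf k,\mathbf l)\eta_b(\mathbf k,\mathbf l)U_{\mathbf l}({}^{\bar{\mathbf k}}a,{}^{\bar{\mathbf k}}b)U_{\mathbf k}(a,b)=U_{\mathbf{kl}}(a,b)\eta_{ab}(\mathbf k,\mathbf l)$. Since $G$ acts trivially on anyons, each $\mathcal{C}_{\mathbf g}$ contains a defect of quantum dimension 1; one is chosen and called $0_{\mathbf g}$ ($0_{\mathbf 0}$ is the trivial anyon), every $\mathbf g$-defect is $a\times0_{\mathbf g}$ for a unique anyon $a$, and $\mathfrak{w}$ is an $\mathcal{A}$-valued 2-cocycle of $G$. Gauge transformations. Vertex basis (phases $\Gamma^{a,b}$, with $\Gamma^{a,0}=\Gamma^{0,b}=\Gamma^{0,0}$):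 $R^{a,b}\to\Gamma^{b,{}^{\bar{\mathbf h}}a}R^{a,b}(\Gamma^{a,b})^{-1}$ for $b\in\mathcal{C}_{\mathbf h}$, $\eta$ unchanged. Symmetry action (phases $\gamma_a(\mathbf k)$, with $\gamma_0(\mathbf k)=\gamma_a(\mathbf 0)=1$): $R^{a,b}\to\gamma_a(\mathbf h)R^{a,b}$ for $b\in\mathcal{C}_{\mathbf h}$, $\eta_x(\mathbf g,\mathbf h)\to\frac{\gamma_x(\mathbf{gh})}{\gamma_x(\mathbf g)\gamma_{{}^{\bar{\mathbf g}}x}(\mathbf h)}\eta_x(\mathbf g,\mathbf h)$. *)

(* Defs.v *)
From HB Require Import structures.
From mathcomp Require Import all_boot all_order all_algebra spectral.
From mathcomp Require Import reals.
From mathcomp.real_closed Require Import complex.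

Set Implicit Arguments.
Unset Strict Implicit.
Unset Printing Implicit Defensive.

Import Order.TTheory GRing.Theory Num.Theory.
Local Open Scope ring_scope.

(* Skeletal G-crossed braided tensor categories over an arbitrary group G, in
   the conventions of Barkeshli-Bonderson-Cheng-Wang.  The neutral element of G
   and the vacuum label are different things: 1%g and [vac]. *)

(* Labels (simple objects), fusion multiplicities, grading and G-action.
   [act k x] is the label ^k x. *)
Record crossed_fusion (G : groupType) := CrossedFusion {
  label :> choiceType;
  vac : label;
  dual : label -> label;
  deg : label -> G;
  act : G -> label -> label;
  fus : label -> label -> label -> nat; (* N_{ab}^c = dim V^{ab}_c *)
  sector : G -> seq label; (* the finitely many simple objects of C_g *)
  sector_uniq : forall g, uniq (sector g);
  mem_sector : forall g x, (x \in sector g) = (deg x == g);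
  fus_deg : forall a b c, (0 < fus a b c)%N -> deg c = (deg a * deg b)%g;
  deg_vac : deg vac = 1%g;
  fus_vacl : forall a c, fus vac a c = (a == c);
  fus_vacr : forall a c, fus a vac c = (a == c);
  fus_dualr : forall a b, fus a b vac = (b == dual a);
  fus_duall : forall a b, fus b a vac = (b == dual a);
  fus_assoc : forall a b c d,
    (\sum_(e <- sector (deg a * deg b)%g) fus a b e * fus e c d
     = \sum_(f <- sector (deg b * deg c)%g) fus b c f * fus a f d)%N;
  act1 : forall x, act 1%g x = x;
  actM : forall g h x, act (g * h)%g x = act g (act h x);
  act_vac : forall g, act g vac = vac;
  deg_act : forall g x, deg (act g x) = (g * deg x * g^-1)%g;
  fus_act : forall g a b c, fus (act g a) (act g b) (act g c) = fus a b c;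
  fus_crossed : forall a b c, fus a b c = fus b (act (deg b)^-1%g a) c
}.

(* Matrix elements are indexed by natural numbers; only the entries with indices
   below the relevant multiplicities are meaningful.  (Ordinal-indexed matrices
   would need transports along identities such as ^{gh}a = ^g(^h a).)

   [F a b c d e al be f mu nu] = [F^{abc}_d]_{(e,al,be),(f,mu,nu)},
     al in V^{ab}_e, be in V^{ec}_d, mu in V^{bc}_f, nu in V^{af}_d;
   [R a b c mu nu] = [R^{ab}_c]_{mu,nu},
     mu in V^{b, ^{h^-1}a}_c with h = deg b, nu in V^{ab}_c;
   [U k a b c mu nu] = [U_k(a,b;c)]_{mu,nu},
     mu in V^{^{k^-1}a, ^{k^-1}b}_{^{k^-1}c}, nu in V^{ab}_c;
   [eta x g h] = eta_x(g,h). *)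
Record symbols (C : numClosedFieldType) (L : Type) (G : Type) := Symbols {
  F : L -> L -> L -> L -> L -> nat -> nat -> L -> nat -> nat -> C;
  R : L -> L -> L -> nat -> nat -> C;
  U : G -> L -> L -> L -> nat -> nat -> C;
  eta : L -> G -> G -> C
}.

Definition entries (C : numClosedFieldType) (m n : nat) (A : nat -> nat -> C) :
  'M[C]_(m, n) := \matrix_(i < m, j < n) A i j.

Section CrossedBTC.
Context {C : numClosedFieldType} {G : groupType}.
Context (X : crossed_fusion G) (D : symbols C X G).

(* Inverse of the (unitary, see [R_unitary]) matrix R^{ab}_c. *)
Definition Rinv (a b c : X) (mu nu : nat) : C := (R D a b c nu mu)^*.

(* R and U are square matrices, by [fus_crossed] and [fus_act], so
   [unitarymx] (A A^dagger = 1) is unitarity for them. *)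
Record is_crossed_btc : Prop := IsCrossedBTC {
  F_unitary_row : forall (a b c d e e' : X) (al be al' be' : nat),
    (al < fus a b e)%N -> (be < fus e c d)%N ->
    (al' < fus a b e')%N -> (be' < fus e' c d)%N ->
    \sum_(f <- sector X (deg b * deg c)%g)
      \sum_(mu < fus b c f) \sum_(nu < fus a f d)
        F D a b c d e al be f mu nu * (F D a b c d e' al' be' f mu nu)^*
    = ((e, al, be) == (e', al', be'))%:R;
  F_unitary_col : forall (a b c d f f' : X) (mu nu mu' nu' : nat),
    (mu < fus b c f)%N -> (nu < fus a f d)%N ->
    (mu' < fus b c f')%N -> (nu' < fus a f' d)%N ->
    \sum_(e <- sector X (deg a * deg b)%g)
      \sum_(al < fus a b e) \sum_(be < fus e c d)
        (F D a b c d e al be f mu nu)^* * F D a b c d e al be f' mu' nu'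
    = ((f, mu, nu) == (f', mu', nu'))%:R;
  R_unitary : forall a b c : X,
    entries (fus b (act (deg b)^-1%g a) c) (fus a b c) (R D a b c)
      \is unitarymx;
  U_unitary : forall k (a b c : X),
    entries (fus (act k^-1%g a) (act k^-1%g b) (act k^-1%g c)) (fus a b c)
      (U D k a b c) \is unitarymx;
  eta_phase : forall (x : X) g h, `|eta D x g h| = 1;

  F_vac1 : forall (b c d : X) (be mu : nat),
    (be < fus b c d)%N -> (mu < fus b c d)%N ->
    F D (vac X) b c d b 0 be d mu 0 = (be == mu)%:R;
  F_vac2 : forall (a c d : X) (be nu : nat),
    (be < fus a c d)%N -> (nu < fus a c d)%N ->
    F D a (vac X) c d a 0 be c 0 nu = (be == nu)%:R;
  F_vac3 : forall (a b d : X) (al nu : nat),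
    (al < fus a b d)%N -> (nu < fus a b d)%N ->
    F D a b (vac X) d d al 0 b 0 nu = (al == nu)%:R;
  U_neutral : forall (a b c : X) (mu nu : nat),
    (mu < fus a b c)%N -> (nu < fus a b c)%N ->
    U D 1%g a b c mu nu = (mu == nu)%:R;
  U_vacl : forall k (b : X), U D k (vac X) b b 0 0 = 1;
  U_vacr : forall k (a : X), U D k a (vac X) a 0 0 = 1;
  eta_vac : forall g h, eta D (vac X) g h = 1;
  eta_neutrall : forall (x : X) h, eta D x 1%g h = 1;
  eta_neutralr : forall (x : X) g, eta D x g 1%g = 1;

  (* rigidity: the zig-zag of a with its dual is nonzero *)
  F_rigid : forall a : X,
    F D a (dual a) a a (vac X) 0 0 (vac X) 0 0 != 0;

  pentagon : forall (a b c d e f g k l : X) (al be ga de la mu : nat),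
    (al < fus a b f)%N -> (be < fus f c g)%N -> (ga < fus g d e)%N ->
    (de < fus c d l)%N -> (la < fus b l k)%N -> (mu < fus a k e)%N ->
    \sum_(nu < fus f l e)
      F D f c d e g be ga l de nu * F D a b l e f al nu k la mu
    = \sum_(h <- sector X (deg b * deg c)%g) \sum_(sg < fus b c h)
        \sum_(ps < fus a h g) \sum_(rh < fus h d k)
          F D a b c g f al be h sg ps * F D a h d e g ps ga k rh mu
            * F D b c d k h sg rh l de la;

  (* naturality of the action and of the G-crossed braiding under the action;
     the eta's compare ^k(^h x) with ^{khk^-1}(^k x) *)
  F_covariant : forall k (a b c d e f : X) (al be mu nu : nat),
    (al < fus a b e)%N -> (be < fus e c d)%N ->
    (mu < fus b c f)%N -> (nu < fus a f d)%N ->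
    let r := act k^-1%g in
    \sum_(al' < fus a b e) \sum_(be' < fus e c d)
      U D k a b e al al' * U D k e c d be be' * F D a b c d e al' be' f mu nu
    = \sum_(mu' < fus b c f) \sum_(nu' < fus a f d)
        F D (r a) (r b) (r c) (r d) (r e) al be (r f) mu' nu'
          * U D k b c f mu' mu * U D k a f d nu' nu;
  R_covariant : forall k (a b c : X) (mu nu : nat),
    let h := deg b in let kt := act k in
    (mu < fus a b c)%N -> (nu < fus a b c)%N ->
    eta D (kt a) (k * h * k^-1)%g k *
      (\sum_(mu' < fus a b c)
         U D k (kt b) (kt (act h^-1%g a)) (kt c) mu mu'
           * R D (kt a) (kt b) (kt c) mu' nu)
    = eta D (kt a) k h *
      (\sum_(nu' < fus a b c)
         R D a b c mu nu' * U D k (kt a) (kt b) (kt c) nu' nu);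

  U_eta : forall k l (a b c : X) (mu nu : nat),
    (mu < fus a b c)%N -> (nu < fus a b c)%N ->
    let r := act k^-1%g in
    eta D a k l * eta D b k l *
      (\sum_(la < fus a b c)
         U D l (r a) (r b) (r c) mu la * U D k a b c la nu)
    = U D (k * l)%g a b c mu nu * eta D c k l;
  eta_cocycle : forall (x : X) g h k,
    eta D x g h * eta D x (g * h)%g k
    = eta D (act g^-1%g x) h k * eta D x g (h * k)%g;

  heptagon1 : forall (a b c d e p : X) (al be mu nu : nat),
    let k := deg c in let r := act k^-1%g in
    (al < fus c (r a) e)%N -> (be < fus e (r b) d)%N ->
    (mu < fus b c p)%N -> (nu < fus a p d)%N ->
    \sum_(la < fus a c e) \sum_(ga < fus c (r b) p)
      R D a c e al la * F D a c (r b) d e la be p ga nu * R D b c p ga mu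
    = \sum_(f <- sector X (deg a * deg b)%g)
        \sum_(de < fus (r a) (r b) (r f)) \sum_(sg < fus c (r f) d)
        \sum_(ep < fus a b f) \sum_(ps < fus f c d)
          F D c (r a) (r b) d e al be (r f) de sg * U D k a b f de ep
            * R D f c d sg ps * F D a b c d f ep ps p mu nu;
  heptagon2 : forall (a b c d e p : X) (al be mu nu : nat),
    let g := deg a in let h := deg b in
    let c1 := act g^-1%g c in let c2 := act h^-1%g c1 in
    (al < fus c a e)%N -> (be < fus e b d)%N ->
    (mu < fus b c2 p)%N -> (nu < fus a p d)%N ->
    \sum_(la < fus a c1 e) \sum_(ga < fus c1 b p)
      Rinv c a e al la * F D a c1 b d e la be p ga nu * Rinv c1 b p ga mu
    = \sum_(f <- sector X (deg a * deg b)%g)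
        \sum_(de < fus a b f) \sum_(sg < fus c f d) \sum_(ps < fus f c2 d)
          F D c a b d e al be f de sg * eta D c g h
            * Rinv c f d sg ps * F D a b c2 d f de ps p mu nu
}.

(* Quantum dimension d_a = |[F^{a abar a}_a]_{0,0}|^-1. *)
Definition qdim (a : X) : C :=
  `|F D a (dual a) a a (vac X) 0 0 (vac X) 0 0|^-1.

(* S_{ab} = trace of the double braid of a and b, over the simple objects of
   the trivial sector. *)
Definition Smatrix :
    'M[C]_(size (sector X 1%g), size (sector X 1%g)) :=
  let s := sector X 1%g in
  \matrix_(i, j)
    let a := nth (vac X) s i in let b := nth (vac X) s j in
    \sum_(c <- s) qdim c *
      \sum_(mu < fus b a c) \sum_(nu < fus a b c)
        R D a b c mu nu * R D b a c nu mu.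

Definition modular : Prop := Smatrix \in unitmx.

Definition anyon (a : X) : Prop := deg a = 1%g.
Definition abelian_anyon (a : X) : Prop := anyon a /\ qdim a = 1.

(* The product of a and b when it is simple (junk otherwise), and the
   R-symbol R^{a,b} of the unique fusion channel. *)
Definition fuse (a b : X) : X :=
  head (vac X) [seq c <- sector X (deg a * deg b)%g | (0 < fus a b c)%N].
Definition Rsym (a b : X) : C := R D a b (fuse a b) 0 0.

(* M_{a,b} = R^{a,b} R^{b,a}. *)
Definition Mbraid (a b : X) : C := Rsym a b * Rsym b a.

(* [ordprod g i] = g_i ... g_1. *)
Fixpoint ordprod (g : nat -> G) (i : nat) : G :=
  if i is j.+1 then (g i * ordprod g j)%g else 1%g.

Definition calF (o : G -> X) (a : X) (n : nat) (g : nat -> G) : C :=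
  (\prod_(1 <= i < n.+1) (Rsym a (o (g i)) * Rsym (o (g i)) a))
    / (Rsym a (o (ordprod g n)) * Rsym (o (ordprod g n)) a)
  * \prod_(1 <= i < n) eta D a (g i.+1) (ordprod g i).

(* Vertex basis transformations: unitaries [Gm a b c] on each V^{ab}_c, acting
   on all the symbols (the inverses are written as conjugate transposes). *)
Record vertex_gauge (Gm : X -> X -> X -> nat -> nat -> C) : Prop :=
  VertexGauge {
    Gm_unitary : forall a b c,
      entries (fus a b c) (fus a b c) (Gm a b c) \is unitarymx;
    Gm_vacr : forall a, Gm a (vac X) a 0%N 0%N = Gm (vac X) (vac X) (vac X) 0%N 0%N;
    Gm_vacl : forall b, Gm (vac X) b b 0%N 0%N = Gm (vac X) (vac X) (vac X) 0%N 0%N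
  }.

Definition vertex_transform (Gm : X -> X -> X -> nat -> nat -> C) :
    symbols C X G :=
  {| F := fun a b c d e al be f mu nu =>
       \sum_(al' < fus a b e) \sum_(be' < fus e c d)
       \sum_(mu' < fus b c f) \sum_(nu' < fus a f d)
         Gm a b e al al' * Gm e c d be be' * F D a b c d e al' be' f mu' nu'
           * (Gm b c f mu mu')^* * (Gm a f d nu nu')^*;
     R := fun a b c mu nu =>
       let a' := act (deg b)^-1%g a in
       \sum_(mu' < fus b a' c) \sum_(nu' < fus a b c)
         Gm b a' c mu mu' * R D a b c mu' nu' * (Gm a b c nu nu')^*;
     U := fun k a b c mu nu =>
       let r := act k^-1%g in
       \sum_(mu' < fus (r a) (r b) (r c)) \sum_(nu' < fus a b c)
         Gm (r a) (r b) (r c) mu mu' * U D k a b c mu' nu' * (Gm a b c nu nu')^*;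
     eta := eta D |}.

(* Symmetry action transformations, with phases [gm a k] = gamma_a(k).  The
   factor on U is the one compatible with heptagon1 and U_eta. *)
Record action_gauge (gm : X -> G -> C) : Prop := ActionGauge {
  gm_phase : forall a k, `|gm a k| = 1;
  gm_vac : forall k, gm (vac X) k = 1;
  gm_neutral : forall a, gm a 1%g = 1
}.

Definition action_transform (gm : X -> G -> C) : symbols C X G :=
  {| F := F D;
     R := fun a b c mu nu => gm a (deg b) * R D a b c mu nu;
     U := fun k a b c mu nu =>
       gm a k * gm b k / gm c k * U D k a b c mu nu;
     eta := fun x g h =>
       gm x (g * h)%g / (gm x g * gm (act g^-1%g x) h) * eta D x g h |}.

End CrossedBTC.

(* Main.v *)
Require Import Defs.
From mathcomp Require Import all_boot all_order all_algebra.
From mathcomp Require Import reals spectral.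
From mathcomp Require Import ring.
From mathcomp.real_closed Require Import complex.
Local Open Scope ring_scope.

(* Dividing the two heptagon equations for the defects x, y and the anyon a
   eliminates the F-symbols and leaves
     M_{a,x} M_{a,y} eta_a(g,h) = M_{a,xy}     (x in C_g, y in C_h invertible).
   Taking (x,y) to be (0_g, 0_h) and (w(g,h), 0_gh), which have the same product,
   gives M_{a,0_g} M_{a,0_h} eta_a(g,h) = M_{a,w(g,h)} M_{a,0_gh}, so that F_a
   telescopes to a product of M_{a,w}'s; on Abelian anyons eta is trivial and
   the same identity makes x |-> M_{a,x} multiplicative. *)

Set Implicit Arguments.
Unset Strict Implicit.
Unset Printing Implicit Defensive.

Import Order.TTheory GRing.Theory Num.Theory.

(** * Fusion rules of invertible objects, by counting multiplicities *)

Section Fusion.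
Context {G : groupType} {X : crossed_fusion G}.
Implicit Types a b c d e f x y z : X.

Definition chan a b c := forall z, fus a b z = (z == c).

(** A substitute for quantum dimension 1 that sees only the fusion rules; [qdim1_invertible] and
    [invertible_qdim1] give the equivalence. *)
Definition invertible a := chan a (dual a) (vac X).

Lemma chan1 a b c : chan a b c -> fus a b c = 1%N.
Proof. by move=> ->; rewrite eqxx. Qed.

Lemma chan_deg a b c : chan a b c -> deg c = (deg a * deg b)%g.
Proof. by move=> h; apply: fus_deg; rewrite (chan1 h). Qed.

Lemma chan_vacl a : chan (vac X) a a.
Proof. by move=> z; rewrite fus_vacl eq_sym. Qed.

Lemma chan_vacr a : chan a (vac X) a.
Proof. by move=> z; rewrite fus_vacr eq_sym. Qed.

Lemma dualK a : dual (dual a) = a.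
Proof.
have h : fus (dual a) a (vac X) = 1%N by rewrite fus_duall eqxx.
by move: h; rewrite fus_dualr; case: eqP.
Qed.

Lemma sum_sector1 (V : nmodType) g c0 (t : X -> V) : deg c0 = g ->
  (forall c, c != c0 -> t c = 0) -> \sum_(c <- sector X g) t c = t c0.
Proof.
move=> hc ht; rewrite (bigD1_seq c0) ?sector_uniq ?mem_sector ?hc ?eqxx //=.
by rewrite big1 ?addr0.
Qed.

Lemma chan_assoc a b c e f d : chan a b e -> chan b c f ->
  fus e c d = fus a f d.
Proof.
move=> hab hbc; have := @fus_assoc G X a b c d.
rewrite (@sum_sector1 nat _ e) ?(chan_deg hab) //; last first.
  by move=> z hz; rewrite hab (negPf hz).
rewrite (@sum_sector1 nat _ f) ?(chan_deg hbc) //; last first.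
  by move=> z hz; rewrite hbc (negPf hz).
by rewrite (chan1 hab) (chan1 hbc) !mul1n.
Qed.

Lemma chan_fuse a b c : chan a b c -> fuse a b = c.
Proof.
move=> h; rewrite /fuse.
have -> : [seq z <- sector X (deg a * deg b)%g | (0 < fus a b z)%N] = [:: c].
  rewrite (@eq_filter _ _ (pred1 c)); last by move=> z /=; rewrite h; case: eqP.
  by rewrite filter_pred1_uniq ?sector_uniq // mem_sector (chan_deg h).
by [].
Qed.

(** Crossed commutativity moves [dual a] past [a] at the cost of an action; comparing vacuum
    channels shows that this action fixes [dual a]. *)
Lemma invertible_dual a : invertible a -> invertible (dual a).
Proof.
move=> h; rewrite /invertible dualK.
have hx z : fus (dual a) a z = fus a (act (deg a)^-1%g (dual a)) z.
  exact: fus_crossed.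
have /eqP e : act (deg a)^-1%g (dual a) == dual a.
  by have := hx (vac X); rewrite fus_duall fus_dualr eqxx; case: eqP.
by move=> z; rewrite hx e h.
Qed.

(** Associativity gives a* (a b) = b, so b occurs exactly once in the total over the channels f of a
    b. Each such f contributes at least once ([back]), which leaves a single channel of multiplicity
    1. *)
Lemma invertible_channel a b : invertible a -> exists c, chan a b c.
Proof.
move=> ha; have ha' := invertible_dual ha; rewrite /invertible dualK in ha'.
have sumE x y d : invertible x ->
    (\sum_(f <- sector X (deg (dual x) * deg y)%g)
       fus (dual x) y f * fus x f d = (d == y))%N.
  move=> hx; rewrite -fus_assoc (@sum_sector1 nat _ (vac X)).
  - by rewrite (chan1 hx) mul1n fus_vacl eq_sym.
  - exact: chan_deg hx.
  - by move=> z hz; rewrite hx (negPf hz).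
have ex x y : invertible x ->
    exists2 f, (0 < fus (dual x) y f)%N & (0 < fus x f y)%N.
  move=> hx; have := sumE x y y hx; rewrite eqxx => h.
  have : (\sum_(f <- sector X (deg (dual x) * deg y)%g)
       fus (dual x) y f * fus x f y != 0)%N by rewrite h.
  rewrite sum_nat_seq_neq0 => /hasP[f _] /=.
  by rewrite muln_eq0 negb_or -!lt0n => /andP[]; exists f.
have back f : (0 < fus a b f)%N -> (0 < fus (dual a) f b)%N.
  move=> h; have [d hd _] := ex a f ha.
  have := sumE (dual a) b d (invertible_dual ha); rewrite dualK => hs.
  have hf : f \in sector X (deg a * deg b)%g.
    by rewrite mem_sector (fus_deg h).
  case: (eqVneq d b) hs hd => [-> //|_ hs hd].
  move/eqP: hs; rewrite sum_nat_seq_eq0 => /allP/(_ f hf) /=.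
  by rewrite muln_eq0 -!leqn0 leqNgt h leqNgt hd.
have [c hc1 hc2] := ex (dual a) b (invertible_dual ha).
rewrite dualK in hc1; exists c => z.
have hcs : c \in sector X (deg a * deg b)%g by rewrite mem_sector (fus_deg hc1).
have := sumE (dual a) b b (invertible_dual ha).
rewrite dualK eqxx (bigD1_seq c) ?sector_uniq //= => hs.
have /eqP hp : (fus a b c * fus (dual a) c b == 1)%N.
  by rewrite eqn_leq muln_gt0 hc1 hc2 andbT -hs leq_addr.
move: hs; rewrite hp => -[] hr.
case: eqVneq => [->|hz]; first by move/eqP: hp; rewrite muln_eq1 => /andP[/eqP].
case: (posnP (fus a b z)) => // hz0; have hzb := back z hz0.
move/eqP: hr; rewrite sum_nat_seq_eq0 => /allP/(_ z).
rewrite mem_sector (fus_deg hz0) eqxx hz /= => /(_ isT).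
by rewrite muln_eq0 -!leqn0 leqNgt hz0 leqNgt hzb.
Qed.

Lemma invertible_fuse a b : invertible a -> chan a b (fuse a b).
Proof.
by move=> /(invertible_channel b) [c h]; rewrite (chan_fuse h).
Qed.

End Fusion.

Lemma prod_nat1_recr (R : pzRingType) (f : nat -> R) m :
  \prod_(1 <= i < m.+2) f i = \prod_(1 <= i < m.+1) f i * f m.+1.
Proof. by rewrite big_nat_recr. Qed.

(** * Consequences of unitarity of the R- and F-symbols *)

Section Braiding.
Context {C : numClosedFieldType} {G : groupType} {X : crossed_fusion G}.
Implicit Types a b c d e f x y z : X.

Lemma unitarymx_entry m n (A : nat -> nat -> C) : m = 1%N -> n = 1%N ->
  entries m n A \is unitarymx -> A 0 0 * (A 0 0)^* = 1.
Proof.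
move=> -> -> /unitarymxP /matrixP/(_ 0 0).
by rewrite !mxE big_ord1 !mxE.
Qed.

Context {D : symbols C X G} (hD : is_crossed_btc D).

Lemma R_phase a b c : chan a b c -> chan b (act (deg b)^-1%g a) c ->
  R D a b c 0 0 * (R D a b c 0 0)^* = 1.
Proof.
by move=> h h'; apply: unitarymx_entry (R_unitary hD a b c); apply: chan1.
Qed.

Lemma F_row_norm a b c d e al be :
  (al < fus a b e)%N -> (be < fus e c d)%N ->
  \sum_(f <- sector X (deg b * deg c)%g)
    \sum_(mu < fus b c f) \sum_(nu < fus a f d)
      `|F D a b c d e al be f mu nu| ^+ 2 = 1.
Proof.
move=> h1 h2; have := F_unitary_row hD h1 h2 h1 h2; rewrite eqxx => hF.
rewrite -[RHS]/(true%:R) -hF.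
by do 3!apply: eq_bigr => ? _; rewrite normCK.
Qed.

(** With unique channels the unit row of F has this single entry. *)
Lemma F_row_neq0 a b c d e f : chan a b e -> chan e c d -> chan b c f ->
  chan a f d -> F D a b c d e 0 0 f 0 0 != 0.
Proof.
move=> h1 h2 h3 h4; apply/eqP => h0.
have := @F_row_norm a b c d e 0 0; rewrite (chan1 h1) (chan1 h2).
rewrite (@sum_sector1 G X C _ f) ?(chan_deg h3) //; last first.
  by move=> z hz; rewrite h3 (negPf hz) big_ord0.
rewrite (chan1 h3) (chan1 h4) !big_ord1 h0 normr0 expr0n => /(_ isT isT) /eqP.
by rewrite eq_sym oner_eq0.
Qed.

(** * Quantum dimension 1 and invertibility *)

Lemma fus_dual_vac a : fus a (dual a) (vac X) = 1%N.
Proof. by rewrite fus_dualr eqxx. Qed.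

Lemma fus_dual_vac' a : fus (dual a) a (vac X) = 1%N.
Proof. by rewrite fus_duall eqxx. Qed.

Lemma fus_vacl1 a : fus (vac X) a a = 1%N.
Proof. exact: chan1 (chan_vacl a). Qed.

Lemma fus_vacr1 a : fus a (vac X) a = 1%N.
Proof. exact: chan1 (chan_vacr a). Qed.

Lemma qdim1_norm a : qdim D a = 1 ->
  `|F D a (dual a) a a (vac X) 0 0 (vac X) 0 0| = 1.
Proof. by rewrite /qdim => /(congr1 GRing.inv); rewrite invrK invr1. Qed.

(** The vacuum entry has modulus 1 and so already exhausts the unit norm of its row. *)
Lemma qdim1_row a h sg ps : qdim D a = 1 -> h != vac X ->
  (sg < fus (dual a) a h)%N -> (ps < fus a h a)%N ->
  F D a (dual a) a a (vac X) 0 0 h sg ps = 0.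
Proof.
move=> ha hh hsg hps.
have := @F_row_norm a (dual a) a a (vac X) 0 0.
rewrite fus_dual_vac fus_vacl1 => /(_ isT isT).
rewrite (bigD1_seq (vac X)) ?sector_uniq ?mem_sector //=; last first.
  by rewrite -(@fus_deg _ _ _ _ (vac X)) // fus_dual_vac'.
rewrite fus_dual_vac' fus_vacr1 !big_ord1 qdim1_norm // expr1n.
rewrite -[RHS]addr0 => /addrI /eqP.
have pos z : 0 <= \sum_(mu < fus (dual a) a z) \sum_(nu < fus a z a)
      `|F D a (dual a) a a (vac X) 0 0 z mu nu| ^+ 2.
  by do 2!apply: sumr_ge0 => ? _; rewrite exprn_ge0.
rewrite psumr_eq0 => [/allP h0|z _]; last exact: pos.
have /h0 : h \in sector X (deg (dual a) * deg a)%g.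
  by rewrite mem_sector (fus_deg (leq_ltn_trans (leq0n _) hsg)).
rewrite hh /= psumr_eq0 => [/allP h1|? _]; last first.
  by apply: sumr_ge0 => ? _; rewrite exprn_ge0.
have := h1 (Ordinal hsg) (mem_index_enum _).
rewrite /= psumr_eq0 => [/allP h2|? _]; last by rewrite exprn_ge0.
have := h2 (Ordinal hps) (mem_index_enum _).
by rewrite /= expf_eq0 /= normr_eq0 => /eqP.
Qed.

(** By [qdim1_row] only h = [vac X] survives in the pentagon for a, a*, a, a* with total charge
    [vac X]; it then says that the zig-zag F-symbols of a and a* are inverse to each other. *)
Lemma qdim1_dual a : qdim D a = 1 -> qdim D (dual a) = 1.
Proof.
move=> ha.
have := @pentagon _ _ _ _ hD a (dual a) a (dual a) (vac X) (vac X) a (dual a)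
  (vac X) 0 0 0 0 0 0.
rewrite !(fus_dual_vac, fus_vacl1, fus_vacr1).
move=> /(_ isT isT isT isT isT isT).
rewrite big_ord1 (F_vac1 hD) ?(F_vac3 hD) ?(fus_dual_vac, fus_vacl1) // mul1r.
rewrite (@sum_sector1 G X C _ (vac X)); first last.
- move=> h hh; apply: big1 => sg _; apply: big1 => ps _; apply: big1 => rh _.
  by rewrite qdim1_row // !mul0r.
- by rewrite -(@fus_deg _ _ _ _ (vac X)) // fus_dual_vac'.
rewrite !(fus_dual_vac', fus_vacl1, fus_vacr1) !big_ord1.
rewrite (F_vac2 hD) ?fus_dual_vac // mulr1 => /(congr1 Num.norm).
rewrite normr1 normrM (qdim1_norm ha) mul1r => h.
by rewrite /qdim dualK -h invr1.
Qed.

(* With p the projector of a (x) a* onto the vacuum channel, quantum dimension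
   1 turns the zig-zag relations into p (x) 1 = 1 (x) p on a (x) a* (x) a (x) a*,
   so that p (x) (1 - p) = 0; the pentagon expresses this in coordinates. *)
Lemma qdim1_invertible a : qdim D a = 1 -> invertible a.
Proof.
move=> ha z; have [->|hz] := eqVneq z (vac X); first exact: fus_dual_vac.
case: (posnP (fus a (dual a) z)) => // hz0; exfalso.
(* For a second channel z, every entry of this unit row will vanish: in its pentagon expansion,
   terms with h != [vac X] die by [qdim1_row] for [a], and the term h = [vac X] dies by [qdim1_row]
   for [dual a]. *)
have := @F_row_norm a (dual a) z z (vac X) 0 0.
rewrite fus_dual_vac fus_vacl1 => /(_ isT isT) /eqP.
rewrite big1 ?(eq_sym 0) ?oner_eq0 // => k _; apply: big1 => la _.
apply: big1 => mu _.
have := @pentagon _ _ _ _ hD a (dual a) a (dual a) z (vac X) a k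
  z 0 0 0 0 la mu.
rewrite !(fus_dual_vac, fus_vacl1, fus_vacr1).
move=> /(_ isT isT hz0 hz0 (ltn_ord _) (ltn_ord _)).
rewrite big_ord1 (F_vac1 hD) // mul1r => ->.
rewrite big1 ?normr0 ?expr0n // => h _.
apply: big1 => sg _; apply: big1 => ps _; apply: big1 => rh _.
have [hh|hh] := eqVneq h (vac X); last by rewrite qdim1_row // !mul0r.
subst h; have hk : k = dual a.
  by have := ltn_ord rh; rewrite {2}fus_vacl; case: eqP.
subst k; have := ltn_ord sg; rewrite {2}fus_dual_vac'.
have := ltn_ord rh; rewrite {2}fus_vacl1.
case: (nat_of_ord rh) => // _; case: (nat_of_ord sg) => // _.
have := @qdim1_row (dual a) z 0 la (qdim1_dual ha) hz.
by rewrite dualK => ->; rewrite ?mulr0.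
Qed.

Lemma invertible_qdim1 a : invertible a -> qdim D a = 1.
Proof.
move=> ha; have := @F_row_norm a (dual a) a a (vac X) 0 0.
rewrite fus_dual_vac fus_vacl1 => /(_ isT isT).
have ha' := invertible_dual ha; rewrite /invertible dualK in ha'.
rewrite (@sum_sector1 G X C _ (vac X)) ?(chan_deg ha') //; last first.
  by move=> z hz; rewrite ha' (negPf hz) big_ord0.
rewrite fus_dual_vac' fus_vacr1 !big_ord1 => /eqP.
by rewrite sqrp_eq1 // => /eqP; rewrite /qdim => ->; rewrite invr1.
Qed.

(** The inverse of c = a b is e = b* a*: c b* = a, hence c e = a a* = 1. *)
Lemma invertible_prod a b c : invertible a -> invertible b -> chan a b c ->
  invertible c.
Proof.
move=> ha hb hc.
have h1 : chan c (dual b) a.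
  by move=> z; rewrite (chan_assoc z hc hb) fus_vacr eq_sym.
have [e he] := invertible_channel (dual a) (invertible_dual hb).
have h : chan c e (vac X).
  by move=> z; rewrite -(chan_assoc z h1 he) ha.
have /eqP ee : e == dual c; last by rewrite /invertible -ee.
  by have := h (vac X); rewrite fus_dualr eqxx; case: eqP.
Qed.

Lemma act_deg1 a x : deg a = 1%g -> act (deg a)^-1%g x = x.
Proof. by move=> ->; rewrite invg1 act1. Qed.

(** * Double braids of a G-invariant anyon with invertible objects *)

Section TrivialAction.
Variable a : X.
Hypotheses (ha : deg a = 1%g) (act_a : forall k, act k a = a).

Lemma Rsym_phase x : invertible x ->
  Rsym D a x * (Rsym D a x)^* = 1 /\ Rsym D x a * (Rsym D x a)^* = 1.
Proof.
move=> hx; have hxa := invertible_fuse a hx.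
have hax : chan a x (fuse x a) by move=> z; rewrite fus_crossed act_a.
rewrite /Rsym (chan_fuse hax); split; apply: R_phase => //.
  by rewrite act_a.
by rewrite act_deg1.
Qed.

Lemma Rsym_neq0 x : invertible x -> Rsym D a x != 0 /\ Rsym D x a != 0.
Proof.
by move=> /Rsym_phase[h1 h2]; split; apply/eqP => h0;
  [move: h1 | move: h2]; rewrite h0 mul0r => /eqP; rewrite eq_sym oner_eq0.
Qed.

Lemma Mbraid_neq0 x : invertible x -> Mbraid D a x != 0.
Proof. by move=> /Rsym_neq0[h1 h2]; rewrite mulf_neq0. Qed.

(* Both heptagons contain F^{x,a,y}; dividing one by the other removes all the
   F-symbols. *)
Lemma Mbraid_mul x y : invertible x -> invertible y ->
  Mbraid D a x * Mbraid D a y * eta D a (deg x) (deg y)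
  = Mbraid D a (fuse x y).
Proof.
move=> hx hy; have hf := invertible_fuse y hx; set f := fuse x y in hf *.
have fI := invertible_prod hx hy hf.
have hxa := invertible_fuse a hx; set e := fuse x a in hxa.
have hya := invertible_fuse a hy; set p := fuse y a in hya.
have hfa := invertible_fuse a fI; set d := fuse f a in hfa.
have swap z c : chan z a c -> chan a z c.
  by move=> h t; rewrite fus_crossed act_a h.
have hax := swap _ _ hxa; have hay := swap _ _ hya; have haf := swap _ _ hfa.
have hey : chan e y d by move=> z; rewrite (chan_assoc z hax hf) haf.
have hxp : chan x p d by move=> z; rewrite -(chan_assoc z hxa hay) hey.
have H1 := @heptagon1 _ _ _ _ hD x y a d e p 0 0 0 0.
have H2 := @heptagon2 _ _ _ _ hD x y a d e p 0 0 0 0.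
move: H1 H2; rewrite /= !act_a ha invg1 !act1.
rewrite (chan1 hxa) (chan1 hax) (chan1 hya) (chan1 hay) (chan1 hxp) (chan1 hey).
move=> /(_ isT isT isT isT) H1 /(_ isT isT isT isT) H2.
move: H1 H2; rewrite !big_ord1.
rewrite !(@sum_sector1 G X C _ f) ?(chan_deg hf) //; first last.
- by move=> z hz; rewrite act1 hf (negPf hz) big_ord0.
- by move=> z hz; rewrite hf (negPf hz) big_ord0.
rewrite !act1 (chan1 hf) (chan1 haf) (chan1 hfa) !big_ord1.
rewrite (U_neutral hD) ?(chan1 hf) // eqxx mulr1.
have [pax pxa] := Rsym_phase hx.
have [pay pya] := Rsym_phase hy.
have [paf pfa] := Rsym_phase fI.
have n1 := F_row_neq0 hax hey hf haf.
have n2 := F_row_neq0 hf hfa hya hxp.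
move: pax pay paf; rewrite /Mbraid /Rsym /Rinv.
rewrite (chan_fuse hxa) (chan_fuse hax) (chan_fuse hya) (chan_fuse hay).
rewrite (chan_fuse hfa) (chan_fuse haf).
move: n1 n2.
set A := F D x a y _ _ _ _ _ _ _; set B := F D a x y _ _ _ _ _ _ _.
set E := F D x y a _ _ _ _ _ _ _.
set rax := R D a x _ _ _; set ray := R D a y _ _ _; set raf := R D a f _ _ _.
set rxa := R D x a _ _ _; set rya := R D y a _ _ _; set rfa := R D f a _ _ _.
set h := eta D a _ _.
move=> n1 n2 pax pay paf H1 H2.
apply: (mulfI (mulf_neq0 n1 n2)).
(* This is the second heptagon with its inverse R-symbols moved across, which are conjugates of
   phases. *)
have H3 : raf * A = B * h * rax * ray * E.
  transitivity (raf * (rax * rax^*) * (ray * ray^*) * A).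
    by rewrite pax pay !mulr1.
  transitivity (raf * rax * ray * (rax^* * A * ray^*)); first by ring.
  rewrite H2; transitivity ((raf * raf^*) * (B * h * rax * ray * E)).
    by ring.
  by rewrite paf mul1r.
transitivity (rxa * rya * (B * h * rax * ray * E)); first by ring.
rewrite -H3; transitivity (raf * (rxa * A * rya)); first by ring.
by rewrite H1; ring.
Qed.

Lemma abelian_invertible x : abelian_anyon D x -> invertible x.
Proof. by case=> _; apply: qdim1_invertible. Qed.

Lemma abelian_vac : abelian_anyon D (vac X).
Proof.
split; first exact: deg_vac.
apply: invertible_qdim1 => z; rewrite fus_vacl.
have /eqP <- : vac X == dual (vac X).
  by have := @fus_dualr G X (vac X) (vac X); rewrite fus_vacl eqxx; case: eqP.
by rewrite eq_sym.
Qed.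

Lemma abelian_fuse x y : abelian_anyon D x -> abelian_anyon D y ->
  abelian_anyon D (fuse x y).
Proof.
move=> hx hy; have ix := abelian_invertible hx; have iy := abelian_invertible hy.
have hf := invertible_fuse y ix; split; last first.
  exact: invertible_qdim1 (invertible_prod ix iy hf).
by rewrite /anyon (chan_deg hf) hx.1 hy.1 mulg1.
Qed.

(** [Mbraid_mul] for the vacuum with itself makes this number idempotent, and it is nonzero. *)
Lemma Mbraid_vac : Mbraid D a (vac X) = 1.
Proof.
have iv := abelian_invertible abelian_vac.
have := Mbraid_mul iv iv; rewrite (chan_fuse (chan_vacl (vac X))) deg_vac.
rewrite (eta_neutrall hD) mulr1 => h.
by apply: (mulfI (Mbraid_neq0 iv)); rewrite mulr1.
Qed.

Lemma Mbraid_fuse x y : abelian_anyon D x -> invertible y ->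
  Mbraid D a x * Mbraid D a y = Mbraid D a (fuse x y).
Proof.
move=> hx hy; rewrite -(Mbraid_mul (abelian_invertible hx) hy).
by rewrite hx.1 (eta_neutrall hD) mulr1.
Qed.

(** * Telescoping over the chosen defects *)

Section Defects.
Context {o : G -> X} {w : G -> G -> X}.
Hypotheses (ho_deg : forall g, deg (o g) = g) (io : forall g, invertible (o g)).
Hypotheses (hw : forall g h, abelian_anyon D (w g h))
  (hfus : forall g h c, fus (o g) (o h) c = fus (w g h) (o (g * h)%g) c).

Lemma Mbraid_defects g h :
  Mbraid D a (o g) * Mbraid D a (o h) * eta D a g h
  = Mbraid D a (w g h) * Mbraid D a (o (g * h)%g).
Proof.
rewrite (Mbraid_fuse (hw g h) (io _)); have := Mbraid_mul (io g) (io h).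
rewrite !ho_deg => ->; congr Mbraid.
have hc := invertible_fuse (o (g * h)%g) (abelian_invertible (hw g h)).
by apply: chan_fuse => z; rewrite hfus hc.
Qed.

(** Appending a defect g to the ordered product t multiplies [calF] by M_{a,0_g} M_{a,0_t}
    eta_a(g,t) / M_{a,0_gt}, which is M_{a,w(g,t)} by [Mbraid_defects]. A single defect gives 1. *)
Lemma calF_prod n (g : nat -> G) :
  calF D o a n.+1 g
  = \prod_(1 <= i < n.+1) Mbraid D a (w (g i.+1) (ordprod g i)).
Proof.
rewrite /calF -[X in X / _ * _]/(\prod_(1 <= i < n.+2) Mbraid D a (o (g i))).
rewrite -[X in _ / X * _]/(Mbraid D a (o (ordprod g n.+1))).
elim: n => [|n IHn].
  by rewrite big_nat1 !big_geq // mulr1 /= mulg1 divff //; apply: Mbraid_neq0.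
rewrite [RHS]prod_nat1_recr -IHn (prod_nat1_recr _ n.+1) [X in _ * X = _]prod_nat1_recr.
rewrite -[ordprod g n.+2]/(g n.+2 * ordprod g n.+1)%g.
set t := ordprod g n.+1; have h := Mbraid_defects (g n.+2) t.
have n1 := Mbraid_neq0 (io t); have n2 := Mbraid_neq0 (io (g n.+2 * t)%g).
move: (\prod_(_ <= i < _) _) (\prod_(_ <= i < _) _) n1 n2 h => P Q.
set x := Mbraid D a (o (g n.+2)); set y := Mbraid D a (o t).
set z := Mbraid D a (o _); set u := Mbraid D a (w _ _); set v := eta D a _ _.
move=> n1 n2 h; apply: (mulIf n2); apply: (mulIf n1).
transitivity (P * Q * (x * y * v)); first by field.
by rewrite h; field.
Qed.

End Defects.
End TrivialAction.
End Braiding.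

(** * Gauge invariance *)

Section Gauge.
Context {C : numClosedFieldType} {G : groupType} {X : crossed_fusion G}.
Context {D : symbols C X G} {a : X} {o : G -> X}.
Hypotheses (ha : deg a = 1%g) (act_a : forall k, act k a = a).
Hypothesis (ho_deg : forall g, deg (o g) = g).

Lemma eq_calF (D' : symbols C X G) n g :
  (forall h, Mbraid D' a (o h) = Mbraid D a (o h)) -> eta D' = eta D ->
  calF D' o a n g = calF D o a n g.
Proof.
rewrite /calF /Mbraid => h ->; rewrite h.
by congr (_ / _ * _); apply: eq_bigr => i _.
Qed.

(** All vertex spaces involved are one-dimensional, and the phases acquired by R^{a,x} and R^{x,a}
    are inverse, so each double braid is already invariant. *)
Lemma calF_vertex_transform Gm n g : (forall g, invertible (o g)) ->
  vertex_gauge Gm -> calF (vertex_transform D Gm) o a n g = calF D o a n g.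
Proof.
move=> io hG; apply: eq_calF => // h; rewrite /Mbraid /Rsym.
have hxa := invertible_fuse a (io h); set c := fuse _ a in hxa *.
have hax : chan a (o h) c by move=> z; rewrite fus_crossed act_a.
rewrite (chan_fuse hax) /= ha invg1 !act1 act_a (chan1 hxa) (chan1 hax).
rewrite !big_ord1.
have p1 := unitarymx_entry (chan1 hxa) (chan1 hxa) (Gm_unitary hG _ _ _).
have p2 := unitarymx_entry (chan1 hax) (chan1 hax) (Gm_unitary hG _ _ _).
set r1 := R _ _ _ _ _ _; set r2 := R _ _ _ _ _ _.
rewrite -[RHS]mulr1 -p1 -[RHS]mulr1 -p2; ring.
Qed.

Lemma calF_action_transform gm n g :
  action_gauge gm -> calF (action_transform D gm) o a n.+1 g = calF D o a n.+1 g.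
Proof.
move=> hG.
(* Only R^{a,0_h} changes: the factor of R^{0_h,a} is [gm (o h) 1], as [a] lies in the trivial
   sector. *)
have hM h : Mbraid (action_transform D gm) a (o h) = gm a h * Mbraid D a (o h).
  rewrite /Mbraid /Rsym /= ha ho_deg (gm_neutral hG); ring.
have n0 h : gm a h != 0 by rewrite -normr_eq0 (gm_phase hG) oner_neq0.
(* The total gauge factor: the coboundaries from eta telescope against the factors from the double
   braids. *)
have {n0}tel : \prod_(1 <= i < n.+2) gm a (g i) / gm a (ordprod g n.+1)
  * \prod_(1 <= i < n.+1)
      (gm a (g i.+1 * ordprod g i)%g / (gm a (g i.+1) * gm a (ordprod g i))) = 1.
  elim: n => [|m IHm].
    by rewrite big_nat1 big_geq // mulr1 /= mulg1 divff.
  rewrite (prod_nat1_recr _ m.+1) [X in _ * X = _]prod_nat1_recr -[RHS]IHm.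
  rewrite -[ordprod g m.+2]/(g m.+2 * ordprod g m.+1)%g.
  set t := ordprod g m.+1.
  have := n0 (g m.+2); have := n0 t; have := n0 (g m.+2 * t)%g.
  clear IHm; move: (\prod_(_ <= i < _) _) (\prod_(_ <= i < _) _) => P Q.
  set x := gm a (_ * _)%g; set y := gm a t; set z := gm a (g _).
  by move=> h1 h2 h3; field; rewrite h1 h2 h3.
rewrite /calF.
rewrite -[X in X / _ * _]/(\prod_(1 <= i < n.+2) Mbraid _ a (o (g i))).
rewrite -[X in _ / X * _]/(Mbraid _ a (o (ordprod g n.+1))).
rewrite -[X in _ = X / _ * _]/(\prod_(1 <= i < n.+2) Mbraid _ a (o (g i))).
rewrite -[X in _ = _ / X * _]/(Mbraid _ a (o (ordprod g n.+1))).
under eq_bigr do rewrite hM.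
under [X in _ * X = _]eq_bigr do rewrite /= act_a.
rewrite hM invfM !(big_split, mul1r) /= -[RHS]mul1r -[X in _ = X * _]tel.
rewrite !big_split /=; ring.
Qed.

End Gauge.

Theorem mainTheorem6 (K : realType) (G : groupType) (X : crossed_fusion G)
    (D : symbols K[i] X G)
    (hD : is_crossed_btc D)
    (hmod : modular D)
    (hperm : forall (k : G) (a : X), anyon a -> act k a = a)
    (* the chosen Abelian defects 0_g and their fusion rules *)
    (o : G -> X)
    (ho_deg : forall g : G, deg (o g) = g)
    (ho_dim : forall g : G, qdim D (o g) = 1)
    (ho_neutral : o 1%g = vac X)
    (w : G -> G -> X)
    (hw : forall g h : G, abelian_anyon D (w g h))
    (hfus : forall (g h : G) (c : X),
       fus (o g) (o h) c = fus (w g h) (o (g * h)%g) c)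
    (n : nat) (hn : (0 < n)%N) (g : nat -> G)
    (a : X) (ha : anyon a) :
  (forall Gm : X -> X -> X -> nat -> nat -> K[i], vertex_gauge Gm ->
     calF (vertex_transform D Gm) o a n g = calF D o a n g) /\
  (forall gm : X -> G -> K[i], action_gauge gm ->
     calF (action_transform D gm) o a n g = calF D o a n g) /\
  let f := \big[@fuse G X/vac X]_(1 <= i < n) w (g i.+1) (ordprod g i) in
  abelian_anyon D f /\ calF D o a n g = Mbraid D a f.
Proof.
have act_a k : act k a = a by apply: hperm.
have io h : invertible (o h) by apply: (qdim1_invertible hD).
case: n hn => // n _; split=> [Gm|]; first exact: calF_vertex_transform.
split=> [gm|f]; first exact: calF_action_transform.
rewrite (calF_prod hD ha act_a ho_deg io hw hfus) /f.
(* Abelianness is carried along the fold because [Mbraid_fuse] needs invertible partial products; it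
   also ensures that [fuse] never takes its junk value. *)
apply: (@big_rec2 _ _ (fun p x => abelian_anyon D x /\ p = Mbraid D a x)).
  by split; [apply: abelian_vac | rewrite (Mbraid_vac hD)].
move=> i p x _ [hx ->]; split; first exact: abelian_fuse.
exact: (Mbraid_fuse hD ha act_a (hw _ _) (abelian_invertible hD hx)).
Qed.
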